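(* Let $G_1,G_2$ be subgroups of an abelian group $\mathcal{G}$ (written multiplicatively) such that $G_2$ is a finitely generated free abelian group of positive rank $r$ and the homomorphism $G_1\times G_2\to\mathcal{G}$, $(g_1,g_2)\mapsto g_1g_2$, is injective. Let $u:G_1\to G_2$ be a function, $\varphi:G_2\to\mathbb{Z}^r$ an isomorphism, $\mathcal{B}\subseteq G_1$ non-empty, and let $X$ be a $(u,\varphi)$-bounded spiked subset of $\mathcal{G}$ with respect to $G_1,G_2$ with base $\mathcal{B}$. Suppose $u$ admits a $\varphi$-moderation. Then the following are equivalent: (i) there exist a $\varphi$-moderation $v$ of $u$ and a subset $M\subseteq G_1$ such that $(X,M_v)$ is a co-minimal pair in $G_1G_2$, where $M_v=\{m\,v(m): m\in M\}$ is the graph of $v|_M$; (ii) $X=\mathcal{B}G_2$ and $\mathcal{B}$ is part of a co-minimal pair in $G_1$.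
   Context: For $y\in\mathbb{Z}^r$, $\mathbb{Z}^r_{<y}$ denotes the set of $x\in\mathbb{Z}^r$ with $x_i<y_i$ for every coordinate $i$. A subset $X\subseteq\mathcal{G}$ is a $(u,\varphi)$-bounded spiked subset with respect to $G_1,G_2$ with base $\mathcal{B}$ if $$\mathcal{B}G_2\subseteq X\subseteq \mathcal{B}G_2\ \sqcup\ \bigsqcup_{g_1\in G_1\setminus\mathcal{B}} g_1\cdot\varphi^{-1}\big(\mathbb{Z}^r_{<\varphi(u(g_1))}\big).$$ A function $v:G_1\to G_2$ is a $\varphi$-moderation of $u$ if for every $g_0\in G_1$ the function $G_1\to\mathbb{Z}^r$, $g\mapsto \varphi(u(g))+\varphi(v(g_0g^{-1}))$, is bounded above (in each coordinate). For non-empty subsets $A,B$ of an abelian group $H$, $(A,B)$ is a co-minimal pair if $AB=H$, $(A\setminus\{a\})B\neq H$ for all $a\in A$, and $A(B\setminus\{b\})\neq H$ for all $b\in B$; a set is part of a co-minimal pair if it is one entry of some co-minimal pair. *)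

(* Defs.v *)
From HB Require Import structures.
From mathcomp Require Import all_boot all_order all_algebra.
From mathcomp Require Import boolp classical_sets functions.

Set Implicit Arguments.
Unset Strict Implicit.
Unset Printing Implicit Defensive.

Import Order.TTheory GRing.Theory Num.Theory.

Local Open Scope classical_set_scope.
Local Open Scope ring_scope.

(* Abelian groups are [zmodType]s, hence written additively: the product of two
   subsets is their Minkowski sum.  Z^r is ['rV[int]_r].  A function between
   subsets of G is a total function on G of which only the restriction to its
   domain is ever constrained or used (see [set_fun], [set_bij]). *)

Section Definitions.
Variable G : zmodType.

Definition is_subgroup (H : set G) : Prop := zmod_closed (mem H).

Definition sumset (A B : set G) : set G := [set a + b | a in A & b in B].

Definition free_of_rank (r : nat) (H : set G) : Prop :=
  exists e : 'I_r -> G, (forall i, H (e i)) /\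
    (forall x, H x -> exists! n : 'rV[int]_r, x = \sum_i e i *~ n 0 i).

Definition iso_Zr (r : nat) (H : set G) (phi : G -> 'rV[int]_r) : Prop :=
  set_bij H setT phi /\
  (forall x y, H x -> H y -> phi (x + y) = phi x + phi y).

Definition Zr_lt (r : nat) (y : 'rV[int]_r) : set 'rV[int]_r :=
  [set x | forall i, x 0 i < y 0 i].

(* The unions need no disjointness clause: they are disjoint as soon as
   (g1, g2) |-> g1 + g2 is injective on G1 x G2. *)
Definition bounded_spiked_subset (r : nat) (G1 G2 : set G) (u : G -> G)
    (phi : G -> 'rV[int]_r) (B X : set G) : Prop :=
  sumset B G2 `<=` X /\
  X `<=` sumset B G2 `|`
    \bigcup_(g1 in G1 `\` B)
      sumset [set g1] (G2 `&` phi @^-1` Zr_lt (phi (u g1))).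

Definition moderation (r : nat) (G1 G2 : set G) (phi : G -> 'rV[int]_r)
    (u v : G -> G) : Prop :=
  set_fun G1 G2 v /\
  forall g0, G1 g0 -> forall i : 'I_r,
    has_ubound [set (phi (u g) + phi (v (g0 - g))) 0 i | g in G1].

Definition co_minimal_pair (H A B : set G) : Prop :=
  [/\ A !=set0 /\ B !=set0,
      A `<=` H /\ B `<=` H,
      sumset A B = H,
      forall a, A a -> sumset (A `\ a) B <> H &
      forall b, B b -> sumset A (B `\ b) <> H].

Definition part_of_co_minimal_pair (H A : set G) : Prop :=
  exists C, co_minimal_pair H A C \/ co_minimal_pair H C A.

Definition graph_set (v : G -> G) (M : set G) : set G :=
  [set m + v m | m in M].

End Definitions.

(* Main.v *)
(* Far out in G2, every spike is overtaken by the moderation: an element g0 + z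
   of G1 + G2 with phi z above the bound attached to g0 can be reached from
   X + M_v only through the cylinder B + G2.  Hence X + M_v = G1 + G2 forces
   B + M = G1, so that the cylinder alone already suffices and minimality of X
   removes the spikes.  For the cylinder itself, co-minimality with M_v in
   G1 + G2 amounts to co-minimality of B with M in G1, whatever v is. *)

Require Import Defs.
From mathcomp Require Import all_boot all_order all_algebra.
From mathcomp Require Import boolp classical_sets functions.

Set Implicit Arguments.
Unset Strict Implicit.
Unset Printing Implicit Defensive.

Import Order.TTheory GRing.Theory Num.Theory.

Local Open Scope classical_set_scope.
Local Open Scope ring_scope.

Section Sumset.
Variable G : zmodType.
Implicit Types A B C H : set G.

Lemma subgroup0 H : is_subgroup H -> H 0.
Proof. by case=> /set_mem. Qed.

Lemma subgroupB H x y : is_subgroup H -> H x -> H y -> H (x - y).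
Proof. by case=> _ HB Hx Hy; apply/set_mem/HB; apply/mem_set. Qed.

Lemma subgroupD H x y : is_subgroup H -> H x -> H y -> H (x + y).
Proof.
move=> HH Hx Hy; rewrite -[y]opprK -[- y]add0r.
by apply: subgroupB => //; apply: subgroupB => //; apply: subgroup0.
Qed.

Lemma sumsetSS A A' B B' :
  A `<=` A' -> B `<=` B' -> sumset A B `<=` sumset A' B'.
Proof.
by move=> sA sB _ [a Aa [b Bb <-]]; exists a; [exact: sA|exists b; [exact: sB|]].
Qed.

Lemma sumsetC A B : sumset A B = sumset B A.
Proof.
by apply/seteqP; split=> _ [a Aa [b Bb <-]]; exists b => //; exists a => //;
  rewrite addrC.
Qed.

Lemma sumset_sub H A B :
  is_subgroup H -> A `<=` H -> B `<=` H -> sumset A B `<=` H.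
Proof.
by move=> HH sA sB _ [a /sA Ha [b /sB Hb <-]]; apply: subgroupD.
Qed.

Lemma co_minimal_pairC H A B : co_minimal_pair H A B -> co_minimal_pair H B A.
Proof.
case=> -[A0 B0] [sA sB] AB mA mB; split=> //; first by rewrite sumsetC.
- by move=> b Bb; rewrite sumsetC; apply: mB.
- by move=> a Aa; rewrite sumsetC; apply: mA.
Qed.

End Sumset.

Section DirectSum.
Variables (G : zmodType) (G1 G2 : set G).
Hypotheses (hG1 : is_subgroup G1) (hG2 : is_subgroup G2).
Hypothesis hinj : set_inj (G1 `*` G2) (fun p : G * G => p.1 + p.2).
Implicit Types A B M : set G.

Lemma direct_sum_inj a a' z z' : G1 a -> G1 a' -> G2 z -> G2 z' ->
  a + z = a' + z' -> a = a' /\ z = z'.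
Proof.
move=> Ga Ga' Gz Gz' E.
suff [-> ->] : (a, z) = (a', z') by [].
by apply: hinj => //; apply/mem_set.
Qed.

(** As 0 lies in [G2], a cylinder contains its own base, and uniqueness of the [G1]-component
    recovers the base from the cylinder. *)
Lemma cylinder_inj A A' : A `<=` G1 -> A' `<=` G1 ->
  sumset A G2 = sumset A' G2 -> A = A'.
Proof.
have sub C C' : C `<=` G1 -> C' `<=` G1 ->
    sumset C G2 = sumset C' G2 -> C `<=` C'.
  move=> sC sC' E c Cc; have G20 := subgroup0 hG2.
  have [c' Cc' [z Gz Ez]] : sumset C' G2 (c + 0).
    by rewrite -E; exists c => //; exists 0.
  by have [<-] := direct_sum_inj (sC' _ Cc') (sC _ Cc) Gz G20 Ez.
by move=> sA sA' E; apply/seteqP; split; apply: sub.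
Qed.

Variable v : G -> G.
Hypothesis hv : set_fun G1 G2 v.

(** [G2] absorbs the heights [v m], so adding the graph over [M] to a cylinder amounts to adding [M]
    to its base. *)
Lemma sumset_cylinder_graph B M : M `<=` G1 ->
  sumset (sumset B G2) (graph_set v M) = sumset (sumset B M) G2.
Proof.
move=> sM; apply/seteqP; split=> x.
  case=> _ [b Bb [z Gz <-]] [_ [m Mm <-] <-].
  exists (b + m); first by exists b => //; exists m.
  exists (z + v m); last exact: addrACA.
  by apply: subgroupD => //; apply/hv/sM.
case=> _ [b Bb [m Mm <-]] [z Gz <-].
(* Subtracting [v m] in advance cancels the height that the graph point brings in. *)
exists (b + (z - v m)).
  exists b => //; exists (z - v m) => //.
  by apply: subgroupB => //; apply/hv/sM.
by exists (m + v m); [exists m|rewrite addrACA subrK].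
Qed.

Lemma cylinder_graph_fullP B M : B `<=` G1 -> M `<=` G1 ->
  sumset (sumset B G2) (graph_set v M) = sumset G1 G2 <-> sumset B M = G1.
Proof.
move=> sB sM; rewrite sumset_cylinder_graph //; split=> [|-> //].
by apply: cylinder_inj => //; apply: sumset_sub.
Qed.

Lemma graph_set_sub M : M `<=` G1 -> graph_set v M `<=` sumset G1 G2.
Proof.
by move=> sM _ [m /sM Gm <-]; exists m => //; exists (v m) => //; apply: hv.
Qed.

(** A graph point [m + v m] determines [m] as its [G1]-component, so distinct points of [M] have
    distinct graph points. *)
Lemma graph_setD1 M m : M `<=` G1 -> M m ->
  graph_set v (M `\ m) = graph_set v M `\ (m + v m).
Proof.
move=> sM Mm; apply/seteqP; split=> [_ [n [Mn nm] <-]|_ [[n Mn <-] nm]].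
  split; first by exists n.
  by case/(direct_sum_inj (sM _ Mn) (sM _ Mm) (hv (sM _ Mn)) (hv (sM _ Mm))).
by exists n => //; split=> // En; apply: nm; rewrite En.
Qed.

(** Fullness transfers by [cylinder_graph_fullP], and minimality of the graph by [graph_setD1]. The
    delicate clause is minimality of the first entry: dropping [b] from [B] removes a whole fibre of
    the cylinder, whereas minimality of the cylinder concerns a single point of it. *)
Lemma co_minimal_cylinderP B M : B `<=` G1 -> M `<=` G1 ->
  co_minimal_pair (sumset G1 G2) (sumset B G2) (graph_set v M) <->
  co_minimal_pair G1 B M.
Proof.
move=> sB sM; have G20 := subgroup0 hG2.
have sBD b : B `\ b `<=` G1 by move=> x [/sB].
have sMD m : M `\ m `<=` G1 by move=> x [/sM].
split=> -[[B0 M0] [sBG sMG] BM mB mM].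
  split=> //.
  - by split; [case: B0 => _ [b Bb _]; exists b|case: M0 => _ [m Mm _]; exists m].
  - exact/cylinder_graph_fullP.
  - move=> b Bb /(cylinder_graph_fullP (sBD b) sM) E.
    apply: (mB b); first by exists b => //; exists 0; rewrite ?addr0.
    apply/seteqP; split.
      by rewrite -[X in _ `<=` X]BM; apply: sumsetSS => // x [].
    rewrite -[X in X `<=` _]E; apply: sumsetSS => // _ [c [Bc cb] [z Gz <-]].
    split; first by exists c => //; exists z.
    rewrite /= -[RHS]addr0.
    by case/(direct_sum_inj (sB _ Bc) (sB _ Bb) Gz G20).
  - move=> m Mm /(cylinder_graph_fullP sB (sMD m)).
    by rewrite graph_setD1 //; apply: mM; exists m.
split.
- by split; [case: B0 => b Bb; exists (b + 0), b => //; exists 0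
            |case: M0 => m Mm; exists (m + v m), m].
- by split; [exact: sumsetSS|exact: graph_set_sub].
- exact/cylinder_graph_fullP.
- (* If g = b + m is not in (B \ b) + M, then b + z is the only element of the
     cylinder through which b + z + m + v m is reached. *)
  move=> _ [b Bb [z Gz <-]] E; apply: (mB b Bb).
  apply/seteqP; split; first by apply: sumset_sub.
  move=> g; rewrite -{1}BM => -[b' Bb' [m Mm <-]].
  have [bb'|bb'] := pselect (b' = b); last by exists b' => //; exists m.
  subst b'.
  have : sumset G1 G2 ((b + m) + (z + v m)).
    exists (b + m); first by apply: subgroupD; auto.
    by exists (z + v m) => //; apply: subgroupD => //; apply/hv/sM.
  rewrite -E => -[_ [[c Bc [y Gy <-]] cb] [_ [n Mn <-] Ec]].
  have Gvn := hv (sM _ Mn); have Gvm := hv (sM _ Mm).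
  move: Ec; rewrite addrACA.
  case/(direct_sum_inj (subgroupD hG1 (sB _ Bc) (sM _ Mn))
    (subgroupD hG1 (sB _ Bb) (sM _ Mm))
    (subgroupD hG2 Gy Gvn) (subgroupD hG2 Gz Gvm)) => Ecn Eyz.
  rewrite -Ecn; exists c; last by exists n.
  (* If [c = b], cancellation gives [n = m] and then [y = z], so [c + y] would be the deleted point
     [b + z]. *)
  split=> // Ecb; apply: cb; move: Ecn Eyz; rewrite /= Ecb => /addrI -> /addIr ->.
  by [].
- move=> _ [m Mm <-]; rewrite -graph_setD1 // => /cylinder_graph_fullP.
  by move=> /(_ sB (sMD m)); apply: mM.
Qed.

Lemma spiked_base_full (r : nat) (u : G -> G) (phi : G -> 'rV[int]_r)
    (B X M : set G) : (0 < r)%N -> iso_Zr G2 phi ->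
  bounded_spiked_subset G1 G2 u phi B X -> moderation G1 G2 phi u v ->
  B `<=` G1 -> M `<=` G1 ->
  sumset X (graph_set v M) = sumset G1 G2 -> sumset B M = G1.
Proof.
move=> r0 [[_ _ phi_surj] phiD] [_ sX] [_ bnd] sB sM E.
apply/seteqP; split=> [|g0 Gg0]; first exact: sumset_sub.
(* [K] collects the bounds that the moderation gives at [g0], one per coordinate. A height [z] with
   [phi z = K] needs no extra margin, because a spike over [g1] stays strictly below
   [phi (u g1)]. *)
have [K ubK] := choice (bnd g0 Gg0).
have [z Gz phiz] := phi_surj (\row_i K i) I.
have : sumset G1 G2 (g0 + z) by exists g0 => //; exists z.
rewrite -E => -[x Xx [_ [m Mm <-]]].
have Gm := sM _ Mm; have Gvm := hv Gm.
(* Through the cylinder, comparing [G1]-components gives [g0 = b + m]; through a spike, the heights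
   will conflict. *)
have [[b Bb [y Gy <-]]|[g1 [Gg1 _] [_ -> [s [Gs phis] <-]]]] := sX _ Xx;
  rewrite addrACA.
  have Gb := sB _ Bb.
  case/(direct_sum_inj (subgroupD hG1 Gb Gm) Gg0 (subgroupD hG2 Gy Gvm) Gz).
  by move=> <- _; exists b => //; exists m.
case/(direct_sum_inj (subgroupD hG1 Gg1 Gm) Gg0 (subgroupD hG2 Gs Gvm) Gz).
(* Positive rank provides a coordinate. There, as [g0 - g1 = m] and [z = s + v m], one gets
   [phi z < phi (u g1) + phi (v m) <= K], although [phi z = K]. *)
move=> Eg Ez; pose i := Ordinal r0.
have : (phi (u g1) + phi (v (g0 - g1))) 0 i <= K i by apply: ubK; exists g1.
rewrite -Eg addrAC subrr add0r mxE => leK.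
have := phis i; rewrite -(ltrD2r (phi (v m) 0 i)) => /lt_le_trans/(_ leK).
have -> : phi s 0 i + phi (v m) 0 i = K i.
  by move: phiz; rewrite -Ez phiD // => /rowP/(_ i); rewrite !mxE.
by rewrite ltxx.
Qed.

End DirectSum.

Theorem theorem4p3 (G : zmodType) (G1 G2 : set G) (r : nat)
    (hG1 : is_subgroup G1) (hG2 : is_subgroup G2)
    (hr : (0 < r)%N) (hfree : free_of_rank r G2)
    (hinj : set_inj (G1 `*` G2) (fun p : G * G => p.1 + p.2))
    (u : G -> G) (hu : set_fun G1 G2 u)
    (phi : G -> 'rV[int]_r) (hphi : iso_Zr G2 phi)
    (B : set G) (hB : B `<=` G1) (hB0 : B !=set0)
    (X : set G) (hX : bounded_spiked_subset G1 G2 u phi B X)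
    (hu_mod : exists v, moderation G1 G2 phi u v) :
  (exists (v : G -> G) (M : set G),
     [/\ moderation G1 G2 phi u v, M `<=` G1 &
         co_minimal_pair (sumset G1 G2) X (graph_set v M)]) <->
  (X = sumset B G2 /\ part_of_co_minimal_pair G1 B).
Proof.
split=> [[v [M [vmod sM XM]]]|[-> [M BM]]].
  have hv := proj1 vmod.
  have XB : X = sumset B G2.
    case: XM => _ _ XMfull mX _.
    have /(cylinder_graph_fullP hG1 hG2 hinj hv hB sM) BMfull :=
      spiked_base_full hG1 hG2 hinj hv hr hphi hX vmod hB sM XMfull.
    apply/seteqP; split=> [x Xx|]; last exact: (proj1 hX).
    apply: contrapT => Bx; apply: (mX x Xx); apply/seteqP; split.
      by rewrite -[X in _ `<=` X]XMfull; apply: sumsetSS => // y [].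
    rewrite -[X in X `<=` _]BMfull; apply: sumsetSS => // y By.
    by split; [exact: (proj1 hX)|move=> Eyx; apply: Bx; rewrite -Eyx].
  split=> //; exists M; left.
  by apply/(co_minimal_cylinderP hG1 hG2 hinj hv hB sM); rewrite -XB.
have {}BM : co_minimal_pair G1 B M by case: BM => // /co_minimal_pairC.
have sM : M `<=` G1 by case: BM => _ [].
(* Any moderation serves here, since the equivalence for cylinders holds for every [v] from [G1] to
   [G2]. *)
have [v vmod] := hu_mod; exists v, M; split=> //.
exact/(co_minimal_cylinderP hG1 hG2 hinj (proj1 vmod) hB sM).
Qed.
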